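(* Let $p$ be a prime with $p\equiv 1\pmod 4$ and let $i$ be a positive integer. Suppose $p+i$ has a divisor $d$ with $d\equiv 3\pmod 4$ such that $4i\mid (p+d)$. Then $4k:=(p+d)/i$ is a positive integer divisible by $4$, and there exist positive integers $x,y,z$ with $$\frac{4}{p}=\frac{1}{x}+\frac{1}{y}+\frac{1}{z},$$ obtained from the ceiling continued fraction expansion of $p/(4k)$, which has three coefficients, via $\frac{4k}{p}=\frac{1}{p_0}+\frac{1}{p_0p_1}+\frac{1}{p_1p_2}$ with $p_2=p$.
   Context: The ceiling continued fraction of a positive real $x$ is obtained by the Euclidean algorithm with the ceiling function: $c_0=\lceil x\rceil$, and while the current value $x_j$ differs from $c_j$, set $x_{j+1}=1/(c_j-x_j)$, $c_{j+1}=\lceil x_{j+1}\rceil$; then $x=c_0-1/(c_1-1/(c_2-\cdots))$. Its convergent numerators satisfy $p_j=c_jp_{j-1}-p_{j-2}$ with $p_{-1}=1$, $p_{-2}=0$. *)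

(* Defs.v *)
From mathcomp Require Import all_boot all_order all_algebra archimedean.

Set Implicit Arguments.
Unset Strict Implicit.
Unset Printing Implicit Defensive.

Import Order.TTheory GRing.Theory Num.Theory.

Local Open Scope ring_scope.

Section CeilingContinuedFraction.
Variable R : archiRealFieldType.
Implicit Types x y : R.

Definition ceil_cf_next y : option R :=
  if y == (Num.ceil y)%:~R then None else Some (1 / ((Num.ceil y)%:~R - y)).

(* The values x_j and coefficients c_j; None means that the algorithm has     *)
(* stopped before step j.                                                     *)
Definition ceil_cf_val x (j : nat) : option R :=
  iter j (obind ceil_cf_next) (Some x).

Definition ceil_cf_coef x (j : nat) : option int :=
  omap Num.ceil (ceil_cf_val x j).

Definition ceil_cf_has_length x (n : nat) : Prop :=
  forall j : nat, isSome (ceil_cf_coef x j) = (j < n)%N.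

(* The pair (p_{j-2}, p_{j-1}), so that j = 0 gives the initial values (0, 1).*)
Fixpoint ceil_cf_num_pair x (j : nat) : int * int :=
  if j is j'.+1 then
    let: (a, b) := ceil_cf_num_pair x j' in
    (b, odflt 0 (ceil_cf_coef x j') * b - a)
  else (0, 1).

(* p_j; past the last coefficient (read as 0) the value is meaningless.       *)
Definition ceil_cf_num x (j : nat) : int := (ceil_cf_num_pair x j.+1).2.

End CeilingContinuedFraction.

(* Main.v *)
Require Import Defs.
From mathcomp Require Import all_boot all_order all_algebra archimedean.
From mathcomp Require Import zify ring lra.

(** Write [p + d = 4ki] and [p + i = d * e]. Primality of [p] makes [i] and [d]
    coprime, and [4ki = p = - i] modulo [d], so [4k + 1 = m * d] for some [m];
    since [d = 3] modulo 4, this forces [2 <= m]. Hence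
    [p / 4k = i - d / 4k = i - 1 / (m - 1 / d)] is a ceiling continued fraction
    with numerators [i], [m * i - 1], [p], and the Egyptian fraction reduces to
    [4k * (m * i - 1) = m * p + 1]. *)

Set Implicit Arguments.
Unset Strict Implicit.
Unset Printing Implicit Defensive.

Import Order.TTheory GRing.Theory Num.Theory.

Local Open Scope ring_scope.

Lemma ceil_subr (R : archiRealFieldType) (c : int) (t : R) :
  0 <= t < 1 -> Num.ceil (c%:~R - t) = c.
Proof.
move=> /andP[t_ge0 t_lt1]; apply: ceil_def.
by rewrite intrD mulrNz ltrD2l ltrN2 t_lt1 gerBl.
Qed.

Lemma ceil_cf_next_subr (R : archiRealFieldType) (c : int) (t : R) :
  0 < t < 1 -> ceil_cf_next (c%:~R - t) = Some t^-1.
Proof.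
move=> /andP[t_gt0 t_lt1]; rewrite /ceil_cf_next ceil_subr ?ltW //.
by rewrite lt_eqF ?gtrBl // subKr div1r.
Qed.

Lemma ceil_cf_next_int (R : archiRealFieldType) (c : int) :
  ceil_cf_next (c%:~R : R) = None.
Proof. by rewrite /ceil_cf_next intrKceil eqxx. Qed.

(** Since [b] and [c] are integers, both are at least 2, so [c] and [b - 1/c] exceed 1 and their
    reciprocals lie strictly between 0 and 1. Each ceiling therefore recovers [a], then [b], and the
    algorithm stops at the integer [c]. *)
Lemma ceil_cf_coef_three (R : archiRealFieldType) (a b c : int) :
  1 < b -> 1 < c -> let x : R := a%:~R - (b%:~R - c%:~R^-1)^-1 in
  ceil_cf_coef x =1 nth None [:: Some a; Some b; Some c].
Proof.
move=> b_gt1 c_gt1 x.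
have b_ge2 : 2 <= b%:~R :> R by rewrite (ler_int _ 2).
have c_ge2 : 2 <= c%:~R :> R by rewrite (ler_int _ 2).
have s_bnd : 0 < (c%:~R : R)^-1 < 1.
  by rewrite invr_gt0 invf_lt1; lra.
have t_bnd : 0 < (b%:~R - (c%:~R : R)^-1)^-1 < 1.
  by rewrite invr_gt0 invf_lt1; lra.
have v1 : ceil_cf_val x 1 = Some (b%:~R - c%:~R^-1).
  by rewrite /ceil_cf_val /= ceil_cf_next_subr // invrK.
have v2 : ceil_cf_val x 2 = Some c%:~R.
  by rewrite /ceil_cf_val iterS -/(ceil_cf_val x 1) v1 /= ceil_cf_next_subr // invrK.
have v3 n : ceil_cf_val x n.+3 = None.
  elim: n => [|n IHn]; rewrite /ceil_cf_val iterS.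
    by rewrite -/(ceil_cf_val x 2) v2 /= ceil_cf_next_int.
  by rewrite -/(ceil_cf_val x n.+3) IHn.
case=> [|[|[|n]]]; rewrite /ceil_cf_coef ?v1 ?v2 ?v3 /= ?nth_nil //.
- by rewrite ceil_subr // (ltW (andP t_bnd).1) (andP t_bnd).2.
- by rewrite ceil_subr // (ltW (andP s_bnd).1) (andP s_bnd).2.
- by rewrite intrKceil.
Qed.

(** The gcd of [i] and [d] divides both [i] and [p + i], hence [p], so it is 1 or [p]. *)
Lemma coprime_of_dvdn_add (p i d : nat) :
  prime p -> (0 < i)%N -> (d %| p + i)%N -> (4 * i %| p + d)%N -> coprime i d.
Proof.
move=> p_prime i_gt0 d_dvd i_dvd.
have g_dvd_p : (gcdn i d %| p)%N.
  by rewrite -(dvdn_addl p (dvdn_gcdl i d)) (dvdn_trans (dvdn_gcdr i d)).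
have p_gt0 := prime_gt0 p_prime.
have /orP[//|/eqP g_eq_p] := (primeP p_prime).2 _ g_dvd_p.
have /dvdnP[i' i_def] : (p %| i)%N by rewrite -g_eq_p dvdn_gcdl.
have le_d := dvdn_leq (ltn_addr i p_gt0) d_dvd.
have le_i := dvdn_leq (ltn_addr d p_gt0) i_dvd.
(* If [p] divides [i], the sizes are incompatible: [d <= p + i] and
   [4 * i <= p + d] give [3 * i <= 2 * p], but [p <= i]. *)
have i'_gt0 : (0 < i')%N by case: i' i_def i_gt0 => // ->.
have : (p <= i)%N by rewrite i_def leq_pmull.
lia.
Qed.

(** Multiplying by [i] gives [(k + 1) * i = (p + i) + d], a multiple of [d]; coprimality cancels
    [i]. The main proof uses this with [4 * k] for [k]. *)
Lemma dvdn_quotient_succ (p i d k : nat) :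
  coprime i d -> (d %| p + i)%N -> (p + d = k * i)%N -> (d %| k.+1)%N.
Proof.
move=> co_id d_dvd k_def; rewrite -(Gauss_dvdl _ (_ : coprime d i)).
  by rewrite mulSn -k_def addnA dvdn_addl // addnC.
by rewrite coprime_sym.
Qed.

Theorem theorem2p3 (R : archiRealFieldType) (p i d : nat)
  (p_prime : prime p) (p_mod4 : (p %% 4 = 1)%N) (i_gt0 : (0 < i)%N)
  (d_dvd : (d %| p + i)%N) (d_mod4 : (d %% 4 = 3)%N)
  (dvd_4i : (4 * i %| p + d)%N) :
  exists k : nat,
    let P := ceil_cf_num (p%:R / (4 * k)%:R : R) in
    [/\ (0 < k)%N,
        (p + d)%:R / i%:R = (4 * k)%:R :> R,
        ceil_cf_has_length (p%:R / (4 * k)%:R : R) 3,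
        P 2%N = p%:Z
        /\ (4 * k)%:R / p%:R = 1 / (P 0%N)%:~R + 1 / (P 0%N * P 1%N)%:~R
                               + 1 / (P 1%N * P 2%N)%:~R :> R
      & exists x y z : nat,
          [/\ [/\ (0 < x)%N, (0 < y)%N & (0 < z)%N],
              4 / p%:R = 1 / x%:R + 1 / y%:R + 1 / z%:R :> R
            & [/\ x%:Z = k%:Z * P 0%N,
                  y%:Z = k%:Z * (P 0%N * P 1%N)
                & z%:Z = k%:Z * (P 1%N * P 2%N)]]].
Proof.
have /dvdnP[k k_def] := dvd_4i; exists k => P.
have p_gt0 := prime_gt0 p_prime.
have k_gt0 : (0 < k)%N by case: k k_def {P} => //; lia.
have pd_def : (p + d = 4 * k * i)%N by rewrite k_def; ring.
have /dvdnP[m m_def] : (d %| (4 * k).+1)%N.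
  by apply: dvdn_quotient_succ pd_def => //; apply: coprime_of_dvdn_add dvd_4i.
(* [m = 1] would give [d = 4k + 1], against [d = 3] modulo 4. *)
have m_gt1 : (1 < m)%N by case: m m_def => [|[|m]] //; lia.
have d_gt1 : (1 < d)%N by case: d d_mod4 {d_dvd dvd_4i k_def pd_def m_def} => [|[|d]].
have q_gt0 : (0 < m * i - 1)%N by rewrite subn_gt0 (leq_trans m_gt1) ?leq_pmulr.
set q := (m * i - 1)%N in q_gt0.
(* Positivity of [q] ensures that the subtraction defining it is not truncated. *)
have q_def : (q + 1 = m * i)%N by rewrite /q subnK // ltnW // -subn_gt0.
have natR_neq0 n : (0 < n)%N -> n%:R != 0 :> R by rewrite pnatr_eq0 -lt0n.
have kR := natR_neq0 k k_gt0; have iR := natR_neq0 i i_gt0.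
have pR := natR_neq0 p p_gt0; have qR := natR_neq0 q q_gt0.
have dR := natR_neq0 d (ltnW d_gt1).
have pd_R : p%:R + d%:R = 4 * k%:R * i%:R :> R by rewrite -natrD pd_def !natrM.
have m_R : 4 * k%:R + 1 = m%:R * d%:R :> R by rewrite -!natrM -m_def -natr1.
have q_R : q%:R + 1 = m%:R * i%:R :> R by rewrite -natrM -q_def natrD.
have x_def : p%:R / (4 * k)%:R = (i%:Z)%:~R - ((m%:Z)%:~R - (d%:Z)%:~R^-1)^-1 :> R.
  have -> : (m%:Z)%:~R - (d%:Z)%:~R^-1 = 4 * k%:R / d%:R :> R.
    rewrite -[(m%:Z)%:~R]/(m%:R) -[(d%:Z)%:~R]/(d%:R).
    have -> : 4 * k%:R = m%:R * d%:R - 1 :> R by rewrite -m_R addrK.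
    by field.
  rewrite -[(i%:Z)%:~R]/(i%:R) natrM.
  have -> : p%:R = 4 * k%:R * i%:R - d%:R :> R by rewrite -pd_R addrK.
  by field; rewrite kR dR.
have coefE := ceil_cf_coef_three R i%:Z (m_gt1 : 1 < m%:Z) (d_gt1 : 1 < d%:Z).
rewrite /= -x_def in coefE.
have P0 : P 0%N = i%:Z.
  by rewrite /P /ceil_cf_num /ceil_cf_num_pair !coefE /=; ring.
have P1 : P 1%N = q%:Z.
  by rewrite /P /ceil_cf_num /ceil_cf_num_pair !coefE /=; lia.
have P2 : P 2%N = p%:Z.
  rewrite /P /ceil_cf_num /ceil_cf_num_pair !coefE /=.
  have q_Z : q%:Z = m%:Z * i%:Z - 1 by lia.
  have m_Z : m%:Z * d%:Z = 4 * k%:Z + 1 by lia.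
  have p_Z : p%:Z = 4 * k%:Z * i%:Z - d%:Z by lia.
  (* The recurrence yields [d * (m * i - 1) - i], which regroups as [(m * d - 1) * i - d]. *)
  have -> : p%:Z = (m%:Z * d%:Z - 1) * i%:Z - d%:Z by rewrite m_Z addrK.
  by ring.
have egypt : 4 * k%:R / p%:R
    = 1 / i%:R + 1 / (i%:R * q%:R) + 1 / (q%:R * p%:R) :> R.
  (* Indeed [4k * (m * i - 1) = m * (p + d) - 4k], and [m * d - 4k = 1]. *)
  have key : 4 * k%:R * q%:R = m%:R * p%:R + 1 :> R.
    have -> : q%:R = m%:R * i%:R - 1 :> R by rewrite -q_R addrK.
    have -> : p%:R = 4 * k%:R * i%:R - d%:R :> R by rewrite -pd_R addrK.
    have -> : 4 * k%:R = m%:R * d%:R - 1 :> R by rewrite -m_R addrK.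
    by ring.
  (* The first two fractions merge because [q + 1 = m * i]; adding the third then gives the
     numerator [m * p + 1] of [key]. *)
  have -> : 1 / i%:R + 1 / (i%:R * q%:R) = m%:R / q%:R :> R.
    have -> : 1 / i%:R + 1 / (i%:R * q%:R) = (q%:R + 1) / (i%:R * q%:R) :> R.
      by field; rewrite iR qR.
    by rewrite q_R; field; rewrite iR qR.
  have -> : 4 * k%:R / p%:R = 4 * k%:R * q%:R / (q%:R * p%:R) :> R.
    by field; rewrite pR qR.
  by rewrite key; field; rewrite pR qR.
rewrite P0 P1 P2; split=> //.
- by rewrite pd_def natrM mulfK.
- by case=> [|[|[|j]]]; rewrite coefE //= nth_nil.
- by split=> //; rewrite !intrM natrM.
(* Dividing the expansion of [4k / p] by [k] multiplies each denominator by [k]. *)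
exists (k * i)%N, (k * (i * q))%N, (k * (q * p))%N; split.
- by rewrite !muln_gt0 k_gt0 i_gt0 q_gt0 p_gt0.
- have -> : 4 / p%:R = 4 * k%:R / p%:R / k%:R :> R by field; rewrite pR kR.
  rewrite egypt !natrM.
  by field; rewrite kR iR qR pR.
- by rewrite !PoszM.
Qed.
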